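(* Let $\mathbb{F}$ be a field and let $K$ be a finite simplicial complex. The following statements are equivalent: (a) $K$ is taut over $\mathbb{F}$. (b) $\mathbb{F}[K]$ is a complete intersection. (c) $K$ is isomorphic to $\partial\Delta^{[n_1]}*\cdots*\partial\Delta^{[n_k]}$ or to $\Delta^{[r]}*\partial\Delta^{[n_1]}*\cdots*\partial\Delta^{[n_k]}$ for some positive integers $n_1,\dots,n_k$ and $r$.
   Context: A finite simplicial complex $K$ with vertex set $V(K)=[m]=\{v_1,\dots,v_m\}$ ($m\ge 0$) contains $\varnothing$ and every singleton $\{v_i\}$ as a face; for $m=0$, $K=\{\varnothing\}$ is the irrelevant complex, of dimension $-1$. For a field $\mathbb{F}$, the Stanley-Reisner ring is $\mathbb{F}[K]=\mathbb{F}[v_1,\dots,v_m]/\mathcal{I}_K$, where $\mathcal{I}_K$ is generated by all squarefree monomials $v_{i_1}\cdots v_{i_s}$ with $\{v_{i_1},\dots,v_{i_s}\}\notin K$. The total Betti number is $\widetilde{D}(K;\mathbb{F})=\dim_{\mathbb{F}}\mathrm{Tor}_{\mathbb{F}[v_1,\dots,v_m]}(\mathbb{F}[K],\mathbb{F})$, where $\mathbb{F}$ is the trivial module; equivalently (Hochster's formula) $\widetilde{D}(K;\mathbb{F})=\sum_{J\subseteq[m]}\sum_{i\ge -1}\dim_{\mathbb{F}}\widetilde{H}_i(K|_J;\mathbb{F})$, where $K|_J$ is the full subcomplex on $J$ and $\widetilde{H}_{-1}(\{\varnothing\};\mathbb{F})=\mathbb{F}$ is the only nonzero reduced homology group of $\{\varnothing\}$.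 $K$ is called taut over $\mathbb{F}$ if $\widetilde{D}(K;\mathbb{F})=2^{m-\dim(K)-1}$. The algebra $\mathbb{F}[v_1,\dots,v_m]/I$ is a complete intersection if $I$ is generated by a regular sequence (the empty sequence being allowed when $I=0$). $\Delta^{[n]}$ is the $(n-1)$-dimensional simplex on $n$ vertices, $\partial\Delta^{[n]}$ is its boundary (with $\partial\Delta^{[1]}=\{\varnothing\}$, the irrelevant complex), and $*$ is the join of simplicial complexes. *)

(* Defs.v *)
From HB Require Import structures.
From mathcomp Require Import all_boot all_order all_algebra.
From mathcomp Require Import mpoly.

Set Implicit Arguments.
Unset Strict Implicit.
Unset Printing Implicit Defensive.

Import GRing.Theory.
Local Open Scope ring_scope.

(* ------------------------------------------------------------------------ *)
(* Simplicial complexes, given by their sets of faces                       *)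

Definition simplicial_complex (V : finType) (K : {set {set V}}) : Prop :=
  [/\ set0 \in K,
      forall v : V, [set v] \in K &
      forall A B : {set V}, A \subset B -> B \in K -> A \in K].

Definition dimK (V : finType) (K : {set {set V}}) : int :=
  (\max_(A in K) #|A|)%:Z - 1.

(* The ambient type may contain points that are not vertices (see
   [boundary] below), so an isomorphism only relates the points whose
   singletons are faces. *)
Definition isomorphic (V W : finType) (K : {set {set V}}) (L : {set {set W}}) :
    Prop :=
  exists f : {v : V | [set v] \in K} -> {w : W | [set w] \in L},
    bijective f /\
    forall A : {set {v : V | [set v] \in K}},
      ([set val v | v in A] \in K) = ([set val (f v) | v in A] \in L).

Definition simplex (n : nat) : {set {set 'I_n}} := [set: {set 'I_n}].

(* For n = 1 this is the irrelevant complex: the only point of 'I_1 is not a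
   vertex of it. *)
Definition boundary (n : nat) : {set {set 'I_n}} :=
  [set A : {set 'I_n} | A != [set: 'I_n]].

Definition join (V W : finType) (K : {set {set V}}) (L : {set {set W}}) :
    {set {set V + W}} :=
  [set A : {set V + W} |
     ([set v | inl v \in A] \in K) && ([set w | inr w \in A] \in L)].

Fixpoint join_points (ns : seq nat) : finType :=
  if ns is n :: ns' then ('I_n + join_points ns')%type else void.

Fixpoint join_boundaries (ns : seq nat) : {set {set join_points ns}} :=
  match ns with
  | [::] => [set set0]
  | n :: ns' => join (boundary n) (join_boundaries ns')
  end.

(* ------------------------------------------------------------------------ *)
(* Ideals and regular sequences                                             *)

Definition gen_ideal (R : comNzRingType) (gs : seq R) (p : R) : Prop :=
  exists c : 'I_(size gs) -> R, p = \sum_(i < size gs) c i * gs`_i.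

Definition regular_sequence (R : comNzRingType) (gs : seq R) : Prop :=
  (forall (i : nat) (p : R), (i < size gs)%N ->
     gen_ideal (take i gs) (p * gs`_i) -> gen_ideal (take i gs) p) /\
  ~ gen_ideal gs 1.

(* The quotient of R by the ideal I is a complete intersection. *)
Definition complete_intersection (R : comNzRingType) (I : R -> Prop) : Prop :=
  exists gs : seq R,
    regular_sequence gs /\ (forall p : R, I p <-> gen_ideal gs p).

Definition sr_ideal (F : fieldType) (m : nat) (K : {set {set 'I_m}}) :
    {mpoly F[m]} -> Prop :=
  gen_ideal [seq \prod_(i in (A : {set 'I_m})) 'X_i | A <- enum (~: K)].

(* ------------------------------------------------------------------------ *)
(* Tor over S = F[v_1, .., v_m] of a quotient S/I and the trivial module F  *)

(* A resolution ... -> S^(rk 1) -> S^(rk 0) -> S/I -> 0 by finitely generated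
   free modules.  Elements of S^n are row vectors, on which matrices act on
   the right; the augmentation sends x to the class of x *m res_aug. *)
Record free_resolution (F : fieldType) (m : nat) (I : {mpoly F[m]} -> Prop) :=
  FreeResolution {
    res_rk : nat -> nat;
    res_diff : forall i : nat, 'M[{mpoly F[m]}]_(res_rk i.+1, res_rk i);
    res_aug : 'cV[{mpoly F[m]}]_(res_rk 0);
    res_aug_surj : exists x : 'rV_(res_rk 0), I ((x *m res_aug) 0 0 - 1);
    res_exact0 : forall x : 'rV_(res_rk 0),
      I ((x *m res_aug) 0 0) <->
      exists y : 'rV_(res_rk 1), x = y *m res_diff 0;
    res_exactS : forall (i : nat) (x : 'rV_(res_rk i.+1)),
      x *m res_diff i = 0 <->
      exists y : 'rV_(res_rk i.+2), x = y *m res_diff i.+1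
  }.

(* A polynomial p acts on the trivial module F as p(0), so tensoring S^n with
   F yields F^n, and tensoring a matrix with F evaluates its entries at 0. *)
Definition res_diff_triv (F : fieldType) (m : nat) (I : {mpoly F[m]} -> Prop)
    (P : free_resolution I) (i : nat) : 'M[F]_(res_rk P i.+1, res_rk P i) :=
  map_mx (meval (fun=> 0)) (res_diff P i).

(* The dimension of Tor_i(S/I, F), computed from the resolution P. *)
Definition tor_dim (F : fieldType) (m : nat) (I : {mpoly F[m]} -> Prop)
    (P : free_resolution I) (i : nat) : nat :=
  (match i with
   | 0 => res_rk P 0
   | j.+1 => \rank (kermx (res_diff_triv P j))
   end - \rank (res_diff_triv P i))%N.

(* The dimension of the direct sum of all Tor_i(S/I, F) is D.  As for Tor
   itself, the choice of the resolution does not matter. *)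
Definition total_tor_dim (F : fieldType) (m : nat) (I : {mpoly F[m]} -> Prop)
    (D : nat) : Prop :=
  exists (P : free_resolution I) (N : nat),
    (forall i : nat, (N <= i)%N -> tor_dim P i = 0%N) /\
    (\sum_(i < N) tor_dim P i)%N = D.

(* The exponent is nonnegative, since dim K <= m - 1. *)
Definition taut (F : fieldType) (m : nat) (K : {set {set 'I_m}}) : Prop :=
  total_tor_dim (@sr_ideal F m K) (2 ^ absz (m%:Z - dimK K - 1)%R)%N.

(* Main.v *)
(** Let [s] be a face of maximal cardinality, [c] the number of vertices outside
    [s], and [J] the ideal generated by these [c] variables.  Then [I_K] is
    contained in [J] and [x^s J] in [I_K], so multiplication by [x^s] on [S/J]
    factors through [S/I_K].  Evaluate resolutions at the point with coordinate
    [t] on [s] and [0] elsewhere, over the field [F(t)]: the Koszul resolution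
    of [S/J] gets zero differentials and [x^s] becomes invertible, so the
    homology of an evaluated resolution of [S/I_K] has dimension at least
    [C(c, i)] in degree [i].  Specialising [t] to [0] only lowers ranks of
    matrices, so [dim Tor_i >= C(c, i)].

    As [dim Tor_1] is at least the number of minimal nonfaces, a taut complex has
    at most [c] of them; then they are pairwise disjoint, which means that [K] is
    a join of boundaries of simplices and possibly a simplex, and that [I_K] is
    generated by a regular sequence.  Conversely, the Koszul complex on a regular
    sequence generating [I_K] has total Betti number [2^k], where [k] is the
    length of the sequence, and comparing it with the Koszul resolution of [S/J]
    at the same point in both directions gives [k = c]. *)

Require Import Defs.
From mathcomp Require Import all_boot all_order all_algebra.
From mathcomp Require Import mpoly zify.

Set Implicit Arguments.
Unset Strict Implicit.
Unset Printing Implicit Defensive.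

Import GRing.Theory.

(** * Ideals given by generators, and regular sequences *)

Section Ideals.

Local Open Scope ring_scope.

Variables (R : comNzRingType).
Implicit Types (gs : seq R) (g p q : R).

Lemma gen_ideal_nil p : gen_ideal [::] p <-> p = 0.
Proof.
split=> [[c ->]|->]; first by rewrite big_ord0.
by exists (fun=> 0); rewrite big_ord0.
Qed.

(** Adding one generator is passing to a quotient by [g] modulo [gs]; this is the form that the
    mapping cone uses. *)
Lemma gen_ideal_rcons gs g p :
  gen_ideal (rcons gs g) p <-> exists q, gen_ideal gs (p - q * g).
Proof.
pose k := size gs.
have bnd (i : 'I_k) : (i < size (rcons gs g))%N.
  by rewrite size_rcons ltnS ltnW.
have nth_lt (i : 'I_k) : (rcons gs g)`_i = gs`_i.
  by rewrite nth_rcons ltn_ord.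
have sum_rcons (c : nat -> R) :
    \sum_(i < size (rcons gs g)) c i * (rcons gs g)`_i
    = \sum_(i < k) c i * gs`_i + c k * g.
  rewrite size_rcons big_ord_recr /= nth_rcons ltnn eqxx.
  by congr (_ + _); apply: eq_bigr => i _; rewrite nth_lt.
(* Coefficients are extended by 0 to all of [nat], so that sums over different ordinal types can
   share them. *)
have total n (c : 'I_n -> R) : exists c' : nat -> R, forall i : 'I_n, c i = c' i.
  exists (fun i => if insub i is Some j then c j else 0).
  by move=> i; rewrite valK.
split=> [[c ->]|[q [c Ec]]].
- have [c' Ec'] := total _ c.
  under eq_bigr do rewrite Ec'.
  rewrite sum_rcons; exists (c' k), (fun i => c' i).
  by rewrite addrK.
- have [c' Ec'] := total _ c.
  exists (fun i => if (i < k)%N then c' i else q).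
  rewrite (sum_rcons (fun i => if (i < k)%N then c' i else q)) ltnn.
  rewrite -[p](subrK (q * g)) Ec; congr (_ + _).
  by apply: eq_bigr => i _; rewrite ltn_ord Ec'.
Qed.

Lemma gen_ideal_mem gs g : g \in gs -> gen_ideal gs g.
Proof.
move=> gP; exists (fun i => ((i : nat) == index g gs)%:R).
have lt_i : (index g gs < size gs)%N by rewrite index_mem.
rewrite (bigD1 (Ordinal lt_i)) //= eqxx mul1r nth_index // big1 ?addr0 // => i.
by rewrite -val_eqE /= => /negPf ->; rewrite mul0r.
Qed.

Lemma gen_ideal0 gs : gen_ideal gs 0.
Proof. by exists (fun=> 0); rewrite big1 // => i _; rewrite mul0r. Qed.

Lemma gen_idealD gs p q : gen_ideal gs p -> gen_ideal gs q -> gen_ideal gs (p + q).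
Proof.
move=> [c ->] [d ->]; exists (fun i => c i + d i).
by rewrite -big_split; apply: eq_bigr => i _; rewrite mulrDl.
Qed.

Lemma gen_idealM gs p q : gen_ideal gs q -> gen_ideal gs (p * q).
Proof.
move=> [c ->]; exists (fun i => p * c i).
by rewrite mulr_sumr; apply: eq_bigr => i _; rewrite mulrA.
Qed.

Lemma gen_ideal_sum gs (T : Type) (r : seq T) (P : pred T) (f : T -> R) :
  (forall i, P i -> gen_ideal gs (f i)) -> gen_ideal gs (\sum_(i <- r | P i) f i).
Proof. by move=> fP; apply: big_ind fP; [exact: gen_ideal0 | exact: gen_idealD]. Qed.

Definition is_ideal (I : R -> Prop) : Prop :=
  [/\ I 0, forall p q, I p -> I q -> I (p + q) & forall p q, I q -> I (p * q)].

Lemma gen_ideal_is_ideal gs : is_ideal (gen_ideal gs).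
Proof. by split; [exact: gen_ideal0 | exact: gen_idealD | exact: gen_idealM]. Qed.

Lemma ker_is_ideal (E : comNzRingType) (h : {rmorphism R -> E}) :
  is_ideal (fun p => h p = 0).
Proof.
split=> [|a b ha hb|a b hb]; first exact: rmorph0.
- by rewrite rmorphD ha hb addr0.
- by rewrite rmorphM hb mulr0.
Qed.

Lemma gen_ideal_sub gs (J : R -> Prop) p :
  is_ideal J -> (forall g, g \in gs -> J g) -> gen_ideal gs p -> J p.
Proof.
move=> [J0 JD JM] gsJ [c ->]; apply: big_ind => // i _.
by apply/JM/gsJ/mem_nth.
Qed.

Lemma gen_ideal_ker gs (E : comNzRingType) (h : {rmorphism R -> E}) p :
  (forall g, g \in gs -> h g = 0) -> gen_ideal gs p -> h p = 0.
Proof. by move=> gs0; apply: gen_ideal_sub (ker_is_ideal h) gs0. Qed.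

Lemma regular_sequence_rcons gs g :
  regular_sequence (rcons gs g) ->
  regular_sequence gs /\ (forall p, gen_ideal gs (p * g) -> gen_ideal gs p).
Proof.
move=> [reg prop]; split; first split.
- move=> i p lt_i; have := reg i p.
  rewrite size_rcons ltnS -cats1 takel_cat ?(ltnW lt_i) // nth_cat lt_i.
  exact.
- move=> gs1; apply/prop/gen_ideal_rcons; exists 0.
  by rewrite mul0r subr0.
- move=> p; have := reg (size gs) p.
  rewrite size_rcons ltnS leqnn -cats1 take_size_cat // nth_cat ltnn subnn.
  exact.
Qed.

End Ideals.

(** * Exactness of a resolution, for matrices instead of single rows *)

Section Resolution.

Local Open Scope ring_scope.

Variables (F : fieldType) (m : nat) (I : {mpoly F[m]} -> Prop).
Variable P : free_resolution I.

Lemma diff_comp i : res_diff P i.+1 *m res_diff P i = 0.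
Proof.
apply/row_matrixP => k; rewrite row_mul row0; apply/res_exactS.
by exists (row k 1%:M); rewrite -row_mul mul1mx.
Qed.

Lemma diff_aug (y : 'rV_(res_rk P 1)) : I ((y *m res_diff P 0 *m res_aug P) 0 0).
Proof. by apply/res_exact0; exists y. Qed.

Lemma exact0_mx n (X : 'M_(n, res_rk P 0)) :
  (forall k, I ((row k X *m res_aug P) 0 0)) -> exists Y, X = Y *m res_diff P 0.
Proof.
move=> X0; have /fin_all_exists [y yE] k :
    exists y : 'rV_(res_rk P 1), row k X = y *m res_diff P 0.
  exact/res_exact0.
exists (\matrix_k y k).
by apply/row_matrixP => k; rewrite row_mul rowK yE.
Qed.

Lemma exactS_mx n i (X : 'M_(n, res_rk P i.+1)) :
  X *m res_diff P i = 0 -> exists Y, X = Y *m res_diff P i.+1.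
Proof.
move=> X0; have /fin_all_exists [y yE] k :
    exists y : 'rV_(res_rk P i.+2), row k X = y *m res_diff P i.+1.
  by apply/res_exactS; rewrite -row_mul X0 row0.
exists (\matrix_k y k).
by apply/row_matrixP => k; rewrite row_mul rowK yE.
Qed.

End Resolution.

(** * The mapping cone of multiplication by a regular element *)

Section Cone.

Local Open Scope ring_scope.

Variables (F : fieldType) (m : nat).
Local Notation S := {mpoly F[m]}.
Variables (I J : S -> Prop) (P : free_resolution I) (g : S).
Hypothesis I_ideal : is_ideal I.
Hypothesis g_regular : forall p, I (p * g) -> I p.
Hypothesis JE : forall p, J p <-> exists q, I (p - q * g).

Local Notation rk := (res_rk P).
Local Notation d := (res_diff P).

(** Degree [i] of the mapping cone of [g] on [P] is the sum of the terms of [P] in degrees [i] and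
    [i - 1]. *)
Definition cone_rk (i : nat) : nat := if i is j.+1 then rk i + rk j else rk 0.

(* A pair [(y, z)] goes to [(y d + g z, - z d)]; putting the sign on [z d]
   makes all the differentials uniform. *)
Definition cone_diff (i : nat) : 'M[S]_(cone_rk i.+1, cone_rk i) :=
  match i with
  | 0 => col_mx (d 0) g%:M
  | j.+1 => block_mx (d j.+1) 0 g%:M (- d j)
  end.

Lemma cone_aug_surj : exists x : 'rV_(cone_rk 0), J ((x *m res_aug P) 0 0 - 1).
Proof.
have [x xP] := res_aug_surj P; exists x; apply/JE; exists 0.
by rewrite mul0r subr0.
Qed.

Lemma cone_exact0 (x : 'rV_(cone_rk 0)) :
  J ((x *m res_aug P) 0 0) <-> exists y : 'rV_(cone_rk 1), x = y *m cone_diff 0.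
Proof.
split=> [/JE [q qP]|[y ->]].
- have [x0 x0P] := res_aug_surj P.
  (* As [x0] lifts 1, subtracting [(q * g) *: x0] moves the augmentation of [x] from [I + (g)] into
     [I]. *)
  have /res_exact0 [y yE] : I (((x - (q * g) *: x0) *m res_aug P) 0 0).
    have -> : ((x - (q * g) *: x0) *m res_aug P) 0 0
      = (x *m res_aug P) 0 0 - q * g
        + (- (q * g)) * ((x0 *m res_aug P) 0 0 - 1).
      rewrite mulmxBl -scalemxAl !mxE.
      by rewrite mulrBr !mulNr mulr1 opprK [- _ + _]addrC addrA subrK.
    by case: I_ideal => _ ID IM; apply: ID => //; apply: IM.
  exists (row_mx y (q *: x0)).
  by rewrite mul_row_col -yE mul_mx_scalar scalerA mulrC subrK.
- rewrite -[y]hsubmxK mul_row_col mulmxDl mxE; apply/JE.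
  exists ((rsubmx y *m res_aug P) 0 0).
  rewrite mul_mx_scalar -scalemxAl [X in _ + X - _]mxE mulrC addrK.
  exact: diff_aug.
Qed.

(** In a cycle [(y, z)] the part [z] is a boundary of [P]: by regularity of [g] in the lowest
    degree, by exactness of [P] above it. Correcting [y] by a multiple of [g] then gives a cycle of
    [P], hence a boundary. *)
Lemma cone_exactS i (x : 'rV_(cone_rk i.+1)) :
  x *m cone_diff i = 0 <->
  exists y : 'rV_(cone_rk i.+2), x = y *m cone_diff i.+1.
Proof.
have lift_kernel (y : 'rV_(rk i.+1)) (z : 'rV_(rk i)) w :
    y *m d i + g *: z = 0 -> z = - (w *m d i) ->
    exists x' : 'rV_(cone_rk i.+2), row_mx y z = x' *m cone_diff i.+1.
  move=> yz0 zE.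
  have /res_exactS [v vE] : (y - g *: w) *m d i = 0.
    by rewrite mulmxBl -scalemxAl -yz0 zE scalerN.
  exists (row_mx v w).
  by rewrite mul_row_block mulmx0 add0r mulmxN -zE -vE mul_mx_scalar subrK.
case: i => [|i] in x lift_kernel *; split.
- rewrite -[x]hsubmxK mul_row_col mul_mx_scalar => x0.
  (* The cycle condition puts [g] times this augmentation in [I], and [g] is regular modulo [I]. *)
  have /res_exact0 [w wE] : I ((rsubmx x *m res_aug P) 0 0).
    apply: g_regular; rewrite mulrC.
    suff -> : g * (rsubmx x *m res_aug P) 0 0
        = - (lsubmx x *m d 0 *m res_aug P) 0 0.
      by rewrite -mulN1r; case: I_ideal => _ _; apply; exact: diff_aug.
    have := congr1 (fun y => (y *m res_aug P) 0 0) x0.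
    rewrite mulmxDl mul0mx -scalemxAl mxE [X in _ + X]mxE [RHS]mxE => /eqP.
    by rewrite addrC addr_eq0 => /eqP.
  by apply: (lift_kernel _ _ (- w)); rewrite ?mulNmx ?opprK.
- case=> y ->; rewrite -mulmxA /= mul_block_col diff_comp mul0mx addr0.
  by rewrite mul_scalar_mx mul_mx_scalar scalerN subrr col_mx0 mulmx0.
- rewrite -[x]hsubmxK mul_row_block mulmx0 add0r mul_mx_scalar mulmxN.
  rewrite -row_mx0 => /eq_row_mx [x0 /eqP]; rewrite oppr_eq0 => /eqP.
  move/res_exactS => [w wE].
  by apply: (lift_kernel _ _ (- w)); rewrite ?mulNmx ?opprK.
- case=> y ->; rewrite -mulmxA /= mulmx_block !mulmx0 !mul0mx !addr0 !diff_comp.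
  rewrite mul_scalar_mx mul_mx_scalar mulNmx mulmxN opprK diff_comp.
  by rewrite scalerN subrr add0r block_mx0 mulmx0.
Qed.

Definition cone : free_resolution J :=
  FreeResolution cone_aug_surj cone_exact0 cone_exactS.

End Cone.

(** * Koszul resolutions *)

Section Koszul.

Local Open Scope ring_scope.

Variables (F : fieldType) (m : nat).
Local Notation S := {mpoly F[m]}.

Definition kills_diff (I : S -> Prop) (P : free_resolution I) (E : comNzRingType)
    (h : {rmorphism S -> E}) : Prop :=
  forall i, map_mx h (res_diff P i) = 0.

Lemma trivial_resolution (I : S -> Prop) :
    (forall p, I p <-> p = 0) ->
  exists P : free_resolution I,
    (forall i, res_rk P i = 'C(0, i)) /\
    forall (E : comNzRingType) (h : {rmorphism S -> E}), kills_diff P h.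
Proof.
move=> IE; pose rk i : nat := if i is 0 then 1%N else 0%N.
pose d i : 'M[S]_(rk i.+1, rk i) := 0.
have surj : exists x : 'rV_(rk 0%N), I ((x *m (1%:M : 'cV_1)) 0 0 - 1).
  by exists 1%:M; apply/IE; rewrite mul1mx mxE subrr.
have exact0 (x : 'rV_(rk 0%N)) :
    I ((x *m (1%:M : 'cV_1)) 0 0) <-> exists y : 'rV_(rk 1%N), x = y *m d 0%N.
  split=> [/IE|[y ->]]; last by apply/IE; rewrite mulmx0 mul0mx mxE.
  rewrite mulmx1 => x0; exists 0; rewrite mulmx0.
  by apply/rowP => j; rewrite [j]ord1 x0 mxE.
have exactS i (x : 'rV_(rk i.+1)) :
    x *m d i = 0 <-> exists y : 'rV_(rk i.+2), x = y *m d i.+1.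
  split=> [_|_]; last by rewrite mulmx0.
  by exists 0; rewrite mulmx0; apply/rowP => -[].
exists (FreeResolution surj exact0 exactS); split; first by case.
by move=> E h i; apply: map_mx0.
Qed.

(** The cone is iterated along the sequence. Its ranks follow Pascal's rule, and its differentials
    only gain blocks [g], 0 and signed old differentials, so they vanish wherever all generators
    do. *)
Lemma koszul_resolution (gs : seq S) (I : S -> Prop) :
    regular_sequence gs -> (forall p, I p <-> gen_ideal gs p) ->
  exists P : free_resolution I,
    (forall i, res_rk P i = 'C(size gs, i)) /\
    forall (E : comNzRingType) (h : {rmorphism S -> E}),
      (forall g, g \in gs -> h g = 0) -> kills_diff P h.
Proof.
elim/last_ind: gs I => [|gs g IHgs] I.
  move=> _ IE; have [|P [rkP dP]] := trivial_resolution (I := I).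
    by move=> p; rewrite IE gen_ideal_nil.
  by exists P; split=> // E h _; apply: dP.
move=> /regular_sequence_rcons [reg g_reg] IE.
have [//|P [rkP dP]] := IHgs (gen_ideal gs) reg.
have IE' p : I p <-> exists q, gen_ideal gs (p - q * g).
  by rewrite IE gen_ideal_rcons.
exists (cone P (gen_ideal_is_ideal gs) g_reg IE'); split.
- case=> [|i] /=; first by rewrite rkP !bin0.
  by rewrite !rkP size_rcons binS.
- move=> E h h0 i.
  have hP : kills_diff P h.
    by apply: dP => a agl; apply: h0; rewrite mem_rcons in_cons agl orbT.
  have hg : h g = 0 by apply: h0; rewrite mem_rcons mem_head.
  case: i => [|i] /=.
  + by rewrite map_col_mx hP map_scalar_mx hg raddf0 col_mx0.
  + rewrite map_block_mx map_mx0 map_scalar_mx hg raddf0 map_mxN !hP.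
    by rewrite oppr0 block_mx0.
Qed.

End Koszul.

(** * Comparison of resolutions: lifting maps and homotopies *)

Section Comparison.

Local Open Scope ring_scope.

Variables (F : fieldType) (m : nat).
Local Notation S := {mpoly F[m]}.

Section Lifts.

Variables (I J : S -> Prop) (P : free_resolution I) (Q : free_resolution J).

(* [lifts u f]: [f] is the degree [i] component of (the beginning of) a chain
   map [P -> Q] over the multiplication [u : S/I -> S/J].  Being a relation, it
   does not require choosing the components of lower degree. *)
Fixpoint lifts (u : S) (i : nat) : 'M[S]_(res_rk P i, res_rk Q i) -> Prop :=
  match i with
  | 0 => fun f => forall x : 'rV_(res_rk P 0),
      J ((x *m f *m res_aug Q) 0 0 - u * (x *m res_aug P) 0 0)
  | j.+1 => fun f =>
      exists2 g, lifts u g & f *m res_diff Q j = res_diff P j *m g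
  end.

Hypothesis J_ideal : is_ideal J.

(** The inductive step of the comparison theorem, with [g] prescribed so that a given component can
    be continued one degree further. *)
Lemma lifts_step u i (g : 'M_(res_rk P i, res_rk Q i)) :
    (forall p, I p -> J (u * p)) -> lifts u g ->
  exists2 f : 'M_(res_rk P i.+1, res_rk Q i.+1),
    lifts u f & f *m res_diff Q i = res_diff P i *m g.
Proof.
move=> uIJ gP; suff [f fE] : exists f, res_diff P i *m g = f *m res_diff Q i.
  by exists f => //=; exists g.
case: i => [|i] in g gP *.
- have [_ JD _] := J_ideal; apply: exact0_mx => k.
  have := gP (row k (res_diff P 0)); rewrite row_mul => /JD.
  move/(_ (u * (row k (res_diff P 0) *m res_aug P) 0 0)).
  rewrite subrK; apply; apply: uIJ.
  by have := diff_aug (P := P) (row k 1%:M); rewrite -row_mul mul1mx.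
- case: gP => g' _ g'E; apply: exactS_mx.
  by rewrite -mulmxA g'E mulmxA diff_comp mul0mx.
Qed.

Lemma lifts_exist u i :
  (forall p, I p -> J (u * p)) -> exists f : 'M_(res_rk P i, res_rk Q i), lifts u f.
Proof.
move=> uIJ; elim: i => [|i [g gP]]; last first.
  by have [f fP _] := lifts_step uIJ gP; exists f.
have [y yP] := res_aug_surj Q.
(* As [y] lifts 1, sending [x] to its augmentation times [u *: y] covers multiplication by [u]. *)
exists (res_aug P *m (u *: y)) => x.
have -> : (x *m (res_aug P *m (u *: y)) *m res_aug Q) 0 0
    = (x *m res_aug P) 0 0 * u * (y *m res_aug Q) 0 0.
  rewrite mulmxA -mulmxA mxE big_ord1 -mulrA; congr (_ * _).
  by rewrite -scalemxAl mxE.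
rewrite [u * _]mulrC -[X in _ - X]mulr1 -mulrBr.
by case: J_ideal => _ _; apply.
Qed.

Lemma liftsB u v i (f g : 'M_(res_rk P i, res_rk Q i)) :
  lifts u f -> lifts v g -> lifts (u - v) (f - g).
Proof.
elim: i f g => [|i IHi] f g; last first.
  move=> [f' f'P f'E] [g' g'P g'E]; exists (f' - g'); first exact: IHi.
  by rewrite mulmxBl f'E g'E mulmxBr.
move=> /= fP gP x; have [_ JD JM] := J_ideal.
have -> : (x *m (f - g) *m res_aug Q) 0 0 - (u - v) * (x *m res_aug P) 0 0
  = ((x *m f *m res_aug Q) 0 0 - u * (x *m res_aug P) 0 0)
    - ((x *m g *m res_aug Q) 0 0 - v * (x *m res_aug P) 0 0).
  by rewrite mulmxBr mulmxBl !mxE mulrBl !opprD !opprK addrACA.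
by apply: JD => //; rewrite -mulN1r; apply: JM.
Qed.

(** Homotopies in different degrees need not match: a single degree suffices to make [f] vanish once
    the differentials do. *)
Definition null_homotopic (i : nat) :
    'M[S]_(res_rk P i, res_rk Q i) -> Prop :=
  match i with
  | 0 => fun f => exists s, f = s *m res_diff Q 0
  | j.+1 => fun f =>
      exists s t, f = s *m res_diff Q j.+1 + res_diff P j *m t
  end.

Lemma lifts0_null_homotopic i (f : 'M_(res_rk P i, res_rk Q i)) :
  lifts 0 f -> null_homotopic f.
Proof.
elim: i f => [|i IHi] f.
  move=> fP; apply: exact0_mx => k.
  have := fP (row k 1%:M).
  by rewrite mul0r subr0 -(row_mul _ _ f) mul1mx.
case=> g /IHi gN fE.
(* Given such a [t], the difference [f - res_diff P i *m t] is a cycle, hence a boundary. The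
   homotopy of [g] one degree below provides [t]. *)
suff [t tE] : exists t, res_diff P i *m t *m res_diff Q i = f *m res_diff Q i.
  have /exactS_mx [s sE] : (f - res_diff P i *m t) *m res_diff Q i = 0.
    by rewrite mulmxBl tE subrr.
  by exists s, t; rewrite -sE subrK.
case: i => [|i] in f g gN fE {IHi} *.
- by case: gN => t tE; exists t; rewrite fE tE mulmxA.
- case: gN => s [t gE]; exists s.
  by rewrite fE gE mulmxDr !mulmxA diff_comp mul0mx addr0.
Qed.

End Lifts.

Lemma lifts_scalar (I : S -> Prop) (P : free_resolution I) u i :
  is_ideal I -> lifts (P := P) (Q := P) u (u%:M : 'M_(res_rk P i)).
Proof.
move=> [I0 _ _]; elim: i => [|i IHi].
  by move=> x; rewrite mul_mx_scalar -scalemxAl mxE subrr.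
by exists u%:M => //; rewrite mul_scalar_mx mul_mx_scalar.
Qed.

Lemma lifts_comp (I J L : S -> Prop) (P : free_resolution I)
    (Q : free_resolution J) (T : free_resolution L) u v i
    (f : 'M_(res_rk P i, res_rk Q i)) (g : 'M_(res_rk Q i, res_rk T i)) :
    is_ideal L -> (forall p, J p -> L (v * p)) ->
  lifts u f -> lifts v g -> lifts (v * u) (f *m g).
Proof.
move=> [_ LD _] vJL; elim: i f g => [|i IHi] f g; last first.
  move=> [f' f'P f'E] [g' g'P g'E]; exists (f' *m g'); first exact: IHi.
  by rewrite -mulmxA g'E mulmxA f'E mulmxA.
move=> /= fP gP x.
have := LD _ _ (gP (x *m f)) (vJL _ (fP x)).
by rewrite mulrBr mulrA addrA subrK mulmxA.
Qed.

End Comparison.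

(** * Lower bounds for the dimension of homology *)

Section HomologyRank.

Local Open Scope ring_scope.

(** The rows of [Y] are cycles and the columns of [L] are functionals that vanish on boundaries; a
    nondegenerate pairing makes the classes of the cycles independent. *)
Lemma homology_rank_ge (E : fieldType) (c n k l : nat) (Y : 'M[E]_(c, n))
    (D0 : 'M_(n, k)) (D1 : 'M_(l, n)) (L : 'M_(n, c)) :
    Y *m D0 = 0 -> D1 *m D0 = 0 -> D1 *m L = 0 -> row_free (Y *m L) ->
  (c <= \rank (kermx D0) - \rank D1)%N.
Proof.
move=> YD DD DL YL; have rkY : \rank Y = c.
  apply/eqP; rewrite eqn_leq rank_leq_row.
  by move: YL => /eqP {1}<-; apply: mxrankM_maxl.
have cap0 : (Y :&: D1)%MS = 0.
  have /submxP [A AE] := capmxSl Y D1.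
  have /submxP [B BE] := capmxSr Y D1.
  have : A *m (Y *m L) = 0 by rewrite mulmxA -AE BE -mulmxA DL mulmx0.
  rewrite AE => /eqP; rewrite mulmx_free_eq0 // => /eqP ->.
  by rewrite mul0mx.
have := mxrank_sum_cap Y D1; rewrite cap0 mxrank0 addn0 rkY => rkE.
have : (Y + D1 <= kermx D0)%MS by rewrite addsmx_sub !sub_kermx YD DD !eqxx.
by move/mxrankS; rewrite rkE; lia.
Qed.

Variables (F : fieldType) (m : nat).
Local Notation S := {mpoly F[m]}.

(** The dimension of the homology of [P] after base change along [h]; evaluation at the origin gives
    [tor_dim]. *)
Definition homdim (I : S -> Prop) (P : free_resolution I) (E : fieldType)
    (h : {rmorphism S -> E}) (i : nat) : nat :=
  (match i with
   | 0 => res_rk P 0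
   | j.+1 => \rank (kermx (map_mx h (res_diff P j)))
   end - \rank (map_mx h (res_diff P i)))%N.

Lemma homdim_kills_diff (I : S -> Prop) (P : free_resolution I) (E : fieldType)
    (h : {rmorphism S -> E}) i :
  kills_diff P h -> homdim P h i = res_rk P i.
Proof.
move=> hP; rewrite /homdim hP mxrank0 subn0.
by case: i => [|i] //; rewrite hP mxrank_ker mxrank0 subn0.
Qed.

(* The composite [Q -> P -> Q] is homotopic to the scalar [v u], and the
   homotopy vanishes under [h]. *)
Lemma rank_le_homdim (I J : S -> Prop) (P : free_resolution I)
    (Q : free_resolution J) (E : fieldType) (h : {rmorphism S -> E}) (u v : S) i :
    is_ideal I -> is_ideal J ->
    (forall p, I p -> J (u * p)) -> (forall p, J p -> I (v * p)) ->
    h u != 0 -> h v != 0 -> kills_diff Q h ->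
  (res_rk Q i <= homdim P h i)%N.
Proof.
move=> I_ideal J_ideal uIJ vJI hu hv hQ.
have [a aP] := lifts_exist P Q J_ideal i uIJ.
have [b bP] := lifts_exist Q P I_ideal i vJI.
have ba : map_mx h b *m map_mx h a = (h (u * v))%:M.
  have /(liftsB J_ideal)/(_ (lifts_scalar Q (u * v) i J_ideal)) :=
    lifts_comp J_ideal uIJ bP aP.
  rewrite subrr => /(lifts0_null_homotopic)  baN.
  have : map_mx h (b *m a - (u * v)%:M) = 0.
    case: i => [|i] in a b aP bP baN *.
      by case: baN => s ->; rewrite map_mxM hQ mulmx0.
    by case: baN => s [t ->]; rewrite map_mxD !map_mxM !hQ mulmx0 mul0mx addr0.
  by rewrite map_mxB map_mxM map_scalar_mx => /eqP; rewrite subr_eq0 => /eqP.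
have ba_free : row_free (map_mx h b *m map_mx h a).
  by rewrite ba row_free_unit unitmxE det_scalar unitrX // unitfE rmorphM mulf_neq0.
have da : map_mx h (res_diff P i) *m map_mx h a = 0.
  have [a' _ a'E] := lifts_step J_ideal uIJ aP.
  by rewrite -map_mxM -a'E map_mxM hQ mulmx0.
case: i => [|i] in a b aP bP ba ba_free da *.
(* Degree 0 has no outgoing differential; the map to the zero space replaces it. *)
- have := @homology_rank_ge E _ _ 0 _ (map_mx h b) 0 _ _ (mulmx0 _ _)
    (mulmx0 _ _) da ba_free.
  by rewrite mxrank_ker mxrank0 subn0.
- apply: homology_rank_ge da ba_free.
  + by case: bP => b' _ b'E; rewrite -map_mxM b'E map_mxM hQ mul0mx.
  + by rewrite -map_mxM diff_comp map_mx0.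
Qed.

End HomologyRank.

(** * Ideals of squarefree monomials *)

Section SquarefreeMonomials.

Local Open Scope ring_scope.

Variables (F : fieldType) (m : nat).
Local Notation S := {mpoly F[m]}.
Implicit Types (A B : {set 'I_m}) (As : seq {set 'I_m}) (p q : S).

Definition mset A : 'X_{1..m} := [multinom (i \in A : nat) | i < m].

Definition xset A : S := 'X_[mset A].

Lemma prod_xset A : \prod_(i in A) 'X_i = xset A.
Proof.
rewrite mprodXE; congr 'X_[_]; apply/mnmP => j.
rewrite mnm_sumE mnmE; have [jA|jA] := boolP (j \in A).
- rewrite (bigD1 j) //= mnm1E eqxx big1 // => i /andP [_ /negPf ij].
  by rewrite mnm1E ij.
- rewrite big1 // => i iA; rewrite mnm1E.
  by case: eqP iA jA => // ->->.
Qed.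

Lemma lem_mset A B : (mset A <= mset B)%MM = (A \subset B).
Proof.
apply/mnm_lepP/subsetP => AB i.
- by move: (AB i); rewrite !mnmE => + iA; rewrite iA; case: (i \in B).
- by rewrite !mnmE; case: (boolP (i \in A)) => // /AB ->.
Qed.

Lemma mset_le0 A : (mset A <= 0)%MM = (A == set0).
Proof.
have -> : 0%MM = mset set0 by apply/mnmP => i; rewrite !mnmE inE.
by rewrite lem_mset subset0.
Qed.

Lemma meval0_mcoeff p : meval (fun=> 0) p = p@_0.
Proof.
rewrite mevalE [in RHS](mpolyE p) raddf_sum; apply: eq_bigr => k _ /=.
rewrite mcoeffZ mcoeffX; congr (_ * _).
case: (pickP (fun i => k i != 0%N)) => [i ki0|k0].
- rewrite (bigD1 i) //= expr0n (negPf ki0) mul0r; case: eqP => // k0.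
  by rewrite k0 mnm0E in ki0.
- have -> : k = 0%MM by apply/mnmP => i; have /negbFE/eqP-> := k0 i; rewrite mnm0E.
  by rewrite eqxx big1 // => i _; rewrite mnm0E expr0.
Qed.

Definition has_divisor As (k : 'X_{1..m}) : bool := has (fun A => (mset A <= k)%MM) As.

(** Membership in a monomial ideal is decided on each monomial of the support separately. *)
Lemma gen_ideal_xsetP As p :
  gen_ideal (map xset As) p <-> forall k, p@_k != 0 -> has_divisor As k.
Proof.
split.
- pose J p := forall k, p@_k != 0 -> has_divisor As k.
  apply: (@gen_ideal_sub _ _ J).
  + split=> [k|a b aJ bJ k|a b bJ k].
    * by rewrite mcoeff0 eqxx.
    * rewrite mcoeffD; have [->|/aJ //] := eqVneq (a@_k) 0.
      by rewrite add0r; apply: bJ.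
    * rewrite -mcoeff_msupp => /msuppM_le /allpairsP [[k1 k2] [/= _]].
      rewrite mcoeff_msupp => /bJ /hasP [A AAs Ak2] ->.
      by apply/hasP; exists A => //; apply: lepm_trans Ak2 (lem_addl _ _).
  + move=> _ /mapP [A AAs ->] k; rewrite mcoeffX.
    have [<- _|_] := eqVneq (mset A) k; last by rewrite eqxx.
    by apply/hasP; exists A => //; apply: lepm_refl.
- move=> pP; rewrite [p]mpolyE big_seq_cond.
  apply: gen_ideal_sum => k; rewrite andbT mcoeff_msupp => /pP /hasP [A AAs Ak].
  rewrite -mul_mpolyC; apply: gen_idealM; rewrite -(submK Ak) mpolyXD.
  by apply/gen_idealM/gen_ideal_mem/map_f.
Qed.

Lemma xset_mem As B :
  gen_ideal (map xset As) (xset B) <-> has (fun A => A \subset B) As.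
Proof.
rewrite gen_ideal_xsetP; split=> [/(_ (mset B))|BAs k].
- rewrite mcoeffX eqxx oner_eq0 => /(_ isT) /hasP [A AAs AB].
  by apply/hasP; exists A; rewrite -?lem_mset.
- rewrite mcoeffX; have [<- _|_] := eqVneq (mset B) k; last by rewrite eqxx.
  by apply: sub_has BAs => A; rewrite lem_mset.
Qed.

(** If [xset A] divides a monomial times [xset B], with [A] and [B] disjoint, then it already
    divides the monomial. *)
Lemma disjoint_regular_sequence As :
    set0 \notin As -> pairwise (fun A B => [disjoint A & B]) As ->
  regular_sequence (map xset As).
Proof.
move=> As0 disj; split.
- move=> i p; rewrite size_map => lt_i.
  rewrite -map_take (nth_map set0) // => /gen_ideal_xsetP pP.
  apply/gen_ideal_xsetP => k pk.
  have /pP/hasP [A AAs Ak] : (p * xset (nth set0 As i))@_(mset (nth set0 As i) + k) != 0.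
    by rewrite mcoeffMX.
  apply/hasP; exists A => //; apply/mnm_lepP => j.
  have dA : [disjoint A & nth set0 As i].
    have [j' lt_j' <-] := nthP set0 AAs.
    move: lt_j'; rewrite size_take lt_i => lt_j'; rewrite nth_take //.
    by apply: (pairwiseP set0 disj); rewrite ?inE // (ltn_trans lt_j').
  move/mnm_lepP: Ak => /(_ j); rewrite !mnmE.
  have [jA|//] := boolP (j \in A).
  by rewrite (disjointFr dA jA).
- move=> /gen_ideal_xsetP /(_ 0%MM); rewrite mcoeff1 eqxx oner_eq0 => /(_ isT).
  by case/hasP => A; rewrite mset_le0 => AAs /eqP A0; rewrite -A0 AAs in As0.
Qed.

End SquarefreeMonomials.

Arguments xset F {m} A.

(** * Generic points and specialisation to the origin *)

Section Specialization.

Local Open Scope ring_scope.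

(** Independence at 0 persists generically, since a determinant that is nonzero at 0 is a nonzero
    polynomial. *)
Lemma rank_specialize_le (F : fieldType) (n k : nat) (M : 'M[{poly F}]_(n, k)) :
  (\rank (map_mx (horner_eval 0%R) M) <= \rank (map_mx (@tofrac _) M))%N.
Proof.
set A := map_mx (horner_eval 0) M.
have /row_fullP [L LA] := col_base_full A.
have /row_freeP [R AR] := row_base_free A.
(* [L] and [R] are one-sided inverses of the factors of [A], so this square matrix of size [\rank A]
   becomes the identity at 0. *)
pose N := map_mx polyC L *m M *m map_mx polyC R.
have N0 : map_mx (horner_eval 0) N = 1%:M.
  have ev0 i j (B : 'M[F]_(i, j)) : map_mx (horner_eval 0) (map_mx polyC B) = B.
    by apply/matrixP => a b; rewrite !mxE /horner_eval hornerC.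
  rewrite !map_mxM !ev0 -/A.
  have -> : L *m A = L *m (col_base A *m row_base A) by rewrite mulmx_base.
  by rewrite mulmxA LA mul1mx AR.
have detN : \det N != 0.
  apply/eqP => detN0; have := det_map_mx (horner_eval 0) N.
  by rewrite N0 det1 detN0 raddf0 => /eqP; rewrite oner_eq0.
have rkN : \rank (map_mx (@tofrac _) N) = \rank A.
  by apply/mxrank_unit; rewrite unitmxE det_map_mx unitfE tofrac_eq0.
rewrite -rkN !map_mxM; apply: leq_trans (mxrankM_maxl _ _) _.
exact: mxrankM_maxr.
Qed.

Variables (F : fieldType) (m : nat).
Local Notation S := {mpoly F[m]}.
Implicit Types (A s : {set 'I_m}).

(** The values stay polynomials in the parameter, so that it can be set to 0. *)
Definition line_point s : {rmorphism S -> {poly F}} :=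
  mmap polyC (fun i => if i \in s then 'X else 0).

(* The point of [F(t)^m] with coordinate [t] on [s] and [0] elsewhere. *)
Definition generic_point s : {rmorphism S -> {fraction {poly F}}} :=
  @tofrac {poly F} \o line_point s.

Definition origin : {rmorphism S -> F} := meval (fun=> 0).

Lemma line_point0 s (p : S) : (line_point s p).[0] = origin p.
Proof.
rewrite [p]mpolyE !raddf_sum horner_sum; apply: eq_bigr => k _ /=.
rewrite mmapZ mmapX mevalZ mevalX hornerM hornerC; congr (_ * _).
rewrite /mmap1 horner_prod; apply: eq_bigr => i _.
by rewrite horner_exp; case: (i \in s); rewrite ?hornerX ?horner0.
Qed.

(** At the generic point both neighbouring differentials have at least the rank they have at the
    origin, so kernels shrink and images grow. *)
Lemma homdim_generic_point_le (I : S -> Prop) (P : free_resolution I) s i :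
  (homdim P (generic_point s) i <= tor_dim P i)%N.
Proof.
have rk_le n k (M : 'M[S]_(n, k)) :
    (\rank (map_mx origin M) <= \rank (map_mx (generic_point s) M))%N.
  have := rank_specialize_le (map_mx (line_point s) M); rewrite -!map_mx_comp.
  suff -> : map_mx (horner_eval 0 \o line_point s) M = map_mx origin M by [].
  by apply/matrixP => a b; rewrite !mxE -(line_point0 s).
rewrite /homdim /tor_dim; apply: leq_sub (rk_le _ _ _).
by case: i => [|i] //; rewrite !mxrank_ker leq_sub2l // rk_le.
Qed.

Lemma generic_point_xset s A :
  generic_point s (xset F A) =
  if A \subset s then tofrac ('X ^+ #|A|) else 0.
Proof.
rewrite -prod_xset rmorph_prod /=.
have ev i : line_point s 'X_i = if i \in s then 'X else 0.
  by rewrite /= mmapX mmap1U.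
under eq_bigr do rewrite ev.
case: ifP => [/subsetP As|/negbT /subsetPn [i iA iNs]].
- rewrite (eq_bigr (fun=> tofrac 'X)) => [|i /As -> //].
  by rewrite prodr_const rmorphXn.
- by rewrite (bigD1 i) //= (negPf iNs) rmorph0 mul0r.
Qed.

End Specialization.

(** * The Stanley-Reisner ideal and its minimal generators *)

Section StanleyReisner.

Local Open Scope ring_scope.

Variables (F : fieldType) (m : nat) (K : {set {set 'I_m}}).
Hypothesis hK : simplicial_complex K.
Local Notation S := {mpoly F[m]}.
Local Notation I := (@sr_ideal F m K).
Implicit Types (A B : {set 'I_m}).

Definition minimal_nonfaces : {set {set 'I_m}} :=
  [set A | minset (fun B => B \notin K) A].

Lemma face_minimal_nonfaces B :
  (B \in K) = all (fun A => ~~ (A \subset B)) (enum minimal_nonfaces).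
Proof.
have [_ _ down] := hK; apply/idP/allP => [BK A|noA].
- rewrite mem_enum inE => /minsetp; apply: contra => AB.
  exact: down AB BK.
- apply/negPn/negP => BK.
  have [A AB Amin] : {A : {set 'I_m} | A \subset B & minset (fun B => B \notin K) A}.
    by case: (minset_exists (P := fun B => B \notin K) BK) => A; exists A.
  by have := noA A; rewrite mem_enum inE AB => /(_ Amin).
Qed.

Lemma set0_minimal_nonface : set0 \notin minimal_nonfaces.
Proof.
have [K0 _ _] := hK.
by apply/negP; rewrite inE => /minsetp; rewrite K0.
Qed.

Lemma sr_idealE : I = gen_ideal (map (xset F) (enum (~: K))).
Proof.
by rewrite /sr_ideal; congr gen_ideal; apply: eq_map => A; rewrite prod_xset.
Qed.

Lemma sr_ideal_is_ideal : is_ideal I.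
Proof. exact: gen_ideal_is_ideal. Qed.

Lemma xset_sr_ideal A : A \notin K -> I (xset F A).
Proof.
by move=> AK; rewrite sr_idealE; apply/gen_ideal_mem/map_f; rewrite mem_enum inE.
Qed.

Lemma sr_ideal_presentation (As : seq {set 'I_m}) :
    (forall B, (B \in K) = all (fun A => ~~ (A \subset B)) As) ->
  forall p, I p <-> gen_ideal (map (xset F) As) p.
Proof.
move=> KE p; rewrite sr_idealE; split; apply: gen_ideal_sub.
- exact: gen_ideal_is_ideal.
- move=> _ /mapP [B BK ->]; apply/xset_mem.
  by move: BK; rewrite mem_enum inE KE -has_predC; under eq_has do rewrite /= negbK.
- exact: gen_ideal_is_ideal.
- move=> _ /mapP [A AAs ->]; rewrite -sr_idealE; apply: xset_sr_ideal.
  by rewrite KE; apply/allPn; exists A; rewrite ?negbK.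
Qed.

Lemma origin_sr_ideal p : I p -> origin F m p = 0.
Proof.
move=> Ip; rewrite /= meval0_mcoeff; apply/eqP; apply: contraT.
move: Ip; rewrite sr_idealE => /gen_ideal_xsetP H /H /hasP [A].
by rewrite mset_le0 mem_enum inE => + /eqP A0; rewrite A0; case: hK => ->.
Qed.

(* For minimal [A], the functional "coefficient of [xset A]" on [I] factors
   through [I] modulo the maximal ideal at the origin. *)
Lemma mcoeff_sr_ideal A p q :
  A \in minimal_nonfaces -> I q -> (p * q)@_(mset A) = p@_0 * q@_(mset A).
Proof.
rewrite inE => /minsetP [AK Amin]; rewrite sr_idealE => Iq.
pose J (q : S) := forall p : S, (p * q)@_(mset A) = p@_0 * q@_(mset A).
suff: J q by [].
apply: gen_ideal_sub Iq => {p q}; first split=> [p|a b aJ bJ p|a b bJ p].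
- by rewrite mulr0 mcoeff0 mulr0.
- by rewrite mulrDr !mcoeffD aJ bJ mulrDr.
- by rewrite mulrA !bJ rmorphM mulrA.
move=> _ /mapP [B + ->] p; rewrite mem_enum inE => BK.
have [->|BA] := eqVneq B A.
  by rewrite -[X in (_ * _)@_X]addm0 mcoeffMX mcoeffX eqxx mulr1.
have noBA (r : S) : (r * xset F B)@_(mset A) = 0.
  apply/eqP; apply: contraT => rB.
  have /gen_ideal_xsetP /(_ _ rB) : gen_ideal (map (xset F) [:: B]) (r * xset F B).
    by apply/gen_idealM/gen_ideal_mem; rewrite mem_head.
  by rewrite /has_divisor /= orbF lem_mset => /(Amin _ BK) /eqP; rewrite (negPf BA).
by rewrite noBA -[xset F B]mul1r noBA mulr0.
Qed.

(** Lifts of the monomials of the minimal nonfaces to degree 1 are cycles at the origin, and the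
    coefficients of these monomials are functionals that separate them. *)
Lemma minimal_nonfaces_le_tor1 (P : free_resolution I) :
  (#|minimal_nonfaces| <= tor_dim P 1)%N.
Proof.
pose c := #|minimal_nonfaces|.
pose A (j : 'I_c) : {set 'I_m} := enum_val j.
have AP j : A j \in minimal_nonfaces by apply: enum_valP.
have AK j : A j \notin K by have := AP j; rewrite inE => /minsetp.
have I_ideal := sr_ideal_is_ideal; have [_ _ IM] := I_ideal.
have [x xP] := res_aug_surj P.
(* The term in degree 0 may have any rank, so [x], a lift of 1, carries the monomials. *)
have /fin_all_exists [y yE] j :
    exists y : 'rV_(res_rk P 1), xset F (A j) *: x = y *m res_diff P 0.
  apply/res_exact0; rewrite -scalemxAl mxE mulrC.
  by apply/IM/xset_sr_ideal.
(* Row [k] lists the coefficients of the element of [I] that the basis vector [k] represents. *)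
pose L : 'M[F]_(res_rk P 1, c) :=
  \matrix_(k, j) ((res_diff P 0 *m res_aug P) k 0)@_(mset (A j)).
have LE n (X : 'M[S]_(n, res_rk P 1)) :
    map_mx (origin F m) X *m L
    = \matrix_(i, j) ((X *m res_diff P 0 *m res_aug P) i 0)@_(mset (A j)).
  apply/matrixP => i j; rewrite -mulmxA !mxE raddf_sum; apply: eq_bigr => k _.
  rewrite !mxE /= meval0_mcoeff -mcoeff_sr_ideal // -?row_mul ?mxE //.
  have := diff_aug (P := P) (row k 1%:M).
  by rewrite -!row_mul mul1mx mxE [X in I X -> _]mxE.
apply: (@homology_rank_ge _ _ _ _ _ (map_mx (origin F m) (\matrix_j y j)) _ _ L).
- rewrite -map_mxM; apply/row_matrixP => j.
  rewrite row0 -map_row row_mul rowK -yE map_mxZ /=.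
  by rewrite [X in X *: _](origin_sr_ideal (xset_sr_ideal (AK j))) scale0r.
- by rewrite -map_mxM diff_comp map_mx0.
- rewrite LE diff_comp mul0mx.
  by apply/matrixP => i j; rewrite !mxE mcoeff0.
- rewrite LE (_ : \matrix_(_, _) _ = 1%:M); first by rewrite row_free_unit unitmx1.
  apply/matrixP => i j; rewrite [LHS]mxE [RHS]mxE.
  (* The augmentation of [x] is 1 only modulo [I]; the error term is an element of [I] times a
     monomial without constant term, so the coefficients in question are 0. *)
  have -> : (\matrix_j y j *m res_diff P 0 *m res_aug P) i 0
      = xset F (A i) + xset F (A i) * ((x *m res_aug P) 0 0 - 1).
    transitivity (row i (\matrix_j y j *m res_diff P 0 *m res_aug P) 0 0).
      by rewrite [RHS]mxE.
    rewrite !row_mul rowK -yE -scalemxAl [LHS]mxE.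
    by rewrite mulrBr mulr1 addrC subrK.
  rewrite mcoeffD mcoeff_sr_ideal // mcoeffX.
  have -> : (xset F (A i))@_0 = 0.
    by rewrite -meval0_mcoeff; apply/origin_sr_ideal/xset_sr_ideal.
  rewrite mul0r addr0; congr (_%:R).
  have [->|ij] := eqVneq i j; first by rewrite eqxx.
  apply/eqP; rewrite eqb0; apply: contra ij => /eqP eqA.
  apply/eqP/enum_val_inj/eqP; rewrite eqEsubset -!lem_mset.
  by rewrite -/(A i) -/(A j) eqA !lepm_refl.
Qed.

End StanleyReisner.

Lemma sum_binomial n : (\sum_(i < n.+1) 'C(n, i) = 2 ^ n)%N.
Proof.
rewrite -[2%N]/(1 + 1)%N expnDn.
by apply: eq_bigr => i _; rewrite !exp1n !muln1.
Qed.

(** * Comparison with the ideal of a face of maximal cardinality *)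

Section Codimension.

Local Open Scope ring_scope.

Variables (F : fieldType) (m : nat) (K : {set {set 'I_m}}) (s : {set 'I_m}).
Hypotheses (hK : simplicial_complex K) (sK : s \in K).
Hypothesis s_max : forall A, A \in K -> (#|A| <= #|s|)%N.
Local Notation S := {mpoly F[m]}.
Local Notation I := (@sr_ideal F m K).
Local Notation c := #|~: s|.

(** The variables are written as monomials of singletons, so that the results on [xset] apply to
    them. *)
Definition facet_gens : seq S := map (xset F) (map set1 (enum (~: s))).

Local Notation facet_ideal := (gen_ideal facet_gens).

Lemma sr_ideal_facet_ideal p : I p -> facet_ideal p.
Proof.
have [_ _ down] := hK; rewrite sr_idealE.
apply: gen_ideal_sub (gen_ideal_is_ideal _) _ => _ /mapP [A + ->].
rewrite mem_enum inE => AK; apply/xset_mem.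
have /subsetPn [i iA iNs] : ~~ (A \subset s).
  by apply: contra AK => As; apply: down As sK.
by apply/hasP; exists [set i]; rewrite ?sub1set // map_f // mem_enum inE.
Qed.

(** By maximality, [s] with one more vertex is a nonface. *)
Lemma facet_ideal_sr_ideal p : facet_ideal p -> I (xset F s * p).
Proof.
have [_ _ down] := hK; have [I0 ID IM] := sr_ideal_is_ideal F K.
apply: (@gen_ideal_sub _ _ (fun p => I (xset F s * p))).
  split=> [|a b aI bI|a b bI]; first by rewrite mulr0.
  - by rewrite mulrDr; apply: ID.
  - by rewrite mulrCA; apply: IM.
move=> _ /mapP [_ /mapP [i + ->] ->]; rewrite mem_enum inE => iNs.
have -> : xset F s * xset F [set i] = xset F (i |: s).
  rewrite -!prod_xset big_setU1 //= mulrC; congr (_ * _).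
  by rewrite big_set1.
apply: xset_sr_ideal; apply: contra iNs => isK.
by have := s_max isK; rewrite cardsU1; case: (i \in s); rewrite // ltnn.
Qed.

Lemma facet_resolution : exists Q : free_resolution facet_ideal,
  (forall i, res_rk Q i = 'C(c, i)) /\ kills_diff Q (generic_point F s).
Proof.
have [||Q [rkQ dQ]] := @koszul_resolution F m facet_gens facet_ideal.
- apply: disjoint_regular_sequence.
  + apply/negP => /mapP [i _ /setP /(_ i)].
    by rewrite !inE eqxx.
  + rewrite pairwise_map; have := enum_uniq (~: s).
    rewrite uniq_pairwise; apply: sub_pairwise => i j /= ij.
    by rewrite disjoints1 inE.
- by [].
exists Q; split=> [i|]; first by rewrite rkQ !size_map -cardE.
apply: dQ => _ /mapP [_ /mapP [i + ->] ->]; rewrite mem_enum inE => iNs.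
by rewrite generic_point_xset sub1set (negPf iNs).
Qed.

Lemma generic_point_facet_neq0 : generic_point F s (xset F s) != 0.
Proof. by rewrite generic_point_xset subxx tofrac_eq0 expf_neq0 ?polyX_eq0. Qed.

Lemma binomial_le_tor_dim (P : free_resolution I) i :
  ('C(c, i) <= tor_dim P i)%N.
Proof.
have [Q [rkQ hQ]] := facet_resolution.
rewrite -rkQ; apply: leq_trans (homdim_generic_point_le P s i).
apply: (rank_le_homdim P (u := 1) (v := xset F s)) hQ.
- exact: sr_ideal_is_ideal.
- exact: gen_ideal_is_ideal.
- by move=> p Ip; rewrite mul1r; apply: sr_ideal_facet_ideal.
- exact: facet_ideal_sr_ideal.
- by rewrite rmorph1 oner_eq0.
- exact: generic_point_facet_neq0.
Qed.

Section RegularGenerators.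

Variable gs : seq S.
Hypotheses (gs_reg : regular_sequence gs) (gsE : forall p, I p <-> gen_ideal gs p).

(** Both Koszul resolutions have zero differentials at the generic point, so comparing them both
    ways in degree 1 equates their ranks there. *)
Lemma size_regular_generators : size gs = c.
Proof.
have [P [rkP dP]] := koszul_resolution gs_reg gsE.
have [Q [rkQ hQ]] := facet_resolution.
have hP : kills_diff P (generic_point F s).
  apply: dP => g /gen_ideal_mem /gsE /sr_ideal_facet_ideal.
  apply: gen_ideal_ker => _ /mapP [_ /mapP [i + ->] ->].
  by rewrite mem_enum inE => iNs; rewrite generic_point_xset sub1set (negPf iNs).
have facet_sr p : facet_ideal p -> I (xset F s * p) := @facet_ideal_sr_ideal p.
have sr_facet p : I p -> facet_ideal (1 * p).
  by rewrite mul1r; apply: sr_ideal_facet_ideal.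
have h1 : generic_point F s 1 != 0 by rewrite rmorph1 oner_eq0.
have I_ideal := sr_ideal_is_ideal F K.
have J_ideal := gen_ideal_is_ideal facet_gens.
have := rank_le_homdim P 1 I_ideal J_ideal sr_facet facet_sr h1
  generic_point_facet_neq0 hQ.
have := rank_le_homdim Q 1 J_ideal I_ideal facet_sr sr_facet
  generic_point_facet_neq0 h1 hP.
rewrite !homdim_kills_diff // rkP rkQ !bin1 => le1 le2.
by apply/eqP; rewrite eqn_leq le1.
Qed.

Lemma total_tor_dim_regular_generators : total_tor_dim I (2 ^ c)%N.
Proof.
have [P [rkP dP]] := koszul_resolution gs_reg gsE.
have oP : kills_diff P (origin F m).
  by apply: dP => g /gen_ideal_mem /gsE; apply: origin_sr_ideal.
have torE i : tor_dim P i = 'C(c, i).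
  by rewrite -size_regular_generators -rkP -(homdim_kills_diff _ oP).
exists P, c.+1; split=> [i lt_i|]; first by rewrite torE bin_small.
by rewrite -sum_binomial; apply: eq_bigr => i _.
Qed.

End RegularGenerators.

(** The lower bounds ['C(c, i)] already add up to the total [2 ^ c], so degree 1 cannot exceed its
    bound [c]. *)
Lemma card_minimal_nonfaces_taut :
  total_tor_dim I (2 ^ c)%N -> (#|minimal_nonfaces K| <= c)%N.
Proof.
case=> P [N [tor0 sumE]].
(* With [c.+2] terms the index 1 occurs even for [c = 0]; the additional binomial coefficient is
   0. *)
have sum_le : (\sum_(i < c.+2) tor_dim P i <= 2 ^ c)%N.
  rewrite -sumE -!(big_mkord predT (tor_dim P)).
  have [le_N|lt_N] := leqP c.+2 N.
    by rewrite [leqRHS](big_cat_nat (n := c.+2)) //= leq_addr.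
  rewrite (big_cat_nat (n := N)) ?(ltnW lt_N) //= [X in (_ + X)%N]big_nat.
  by rewrite [X in (_ + X)%N]big1 ?addn0 // => i /andP [/tor0].
have sumC : (\sum_(i < c.+2) 'C(c, i) = 2 ^ c)%N.
  by rewrite big_ord_recr /= sum_binomial bin_small // addn0.
pose one : 'I_c.+2 := Ordinal (isT : (1 < c.+2)%N).
move: sum_le; rewrite -sumC (bigD1 one) //= [leqRHS](bigD1 one) //= bin1.
have rest : (\sum_(i < c.+2 | i != one) 'C(c, i)
    <= \sum_(i < c.+2 | i != one) tor_dim P i)%N.
  by apply: leq_sum => i _; apply: binomial_le_tor_dim.
move=> sum_le; rewrite -(leq_add2r (\sum_(i < c.+2 | i != one) 'C(c, i))%N).
by apply: leq_trans (leq_add (minimal_nonfaces_le_tor1 hK P) rest) sum_le.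
Qed.

(* If two minimal nonfaces met, a vertex common to both and one vertex for each
   of the others would hit all of them, and the complement of these vertices
   would be too large a face. *)
Lemma few_minimal_nonfaces_disjoint :
  (#|minimal_nonfaces K| <= c)%N ->
  pairwise (fun A B : {set 'I_m} => [disjoint A & B]) (enum (minimal_nonfaces K)).
Proof.
set M := minimal_nonfaces K => leM.
have := enum_uniq M; rewrite uniq_pairwise.
apply: (@sub_in_pairwise _ (mem M)); last first.
  by apply/allP => A; rewrite mem_enum.
move=> A B AM BM /= AB; apply: contraT => /pred0Pn [v /andP [vA vB]].
(* The default [v] is never taken on [M], whose members are nonempty. *)
pose t (C : {set 'I_m}) := odflt v [pick x in C].
have tP C : C \in M -> t C \in C.
  move=> CM; rewrite /t; case: pickP => //= C0; move: CM.
  suff -> : C = set0 by rewrite (negPf (set0_minimal_nonface hK)).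
  by apply/setP => x; rewrite inE C0.
pose H := v |: [set t C | C in M :\ A :\ B].
have HK : ~: H \in K.
  rewrite (face_minimal_nonfaces hK); apply/allP => C; rewrite mem_enum -/M => CM.
  apply/subsetPn; have [vC|vC] := boolP (v \in C).
    by exists v => //; rewrite !inE eqxx.
  exists (t C); first exact: tP.
  rewrite inE negbK in_setU1; apply/orP; right; apply: imset_f.
  by rewrite !in_setD1 CM andbT; apply/andP; split; apply: contraNneq vC => ->.
(* [H] has at most [#|M| - 1] points, fewer than [c], so the face [~: H] would be larger than
   [s]. *)
have := s_max HK; have := cardsC H; have := cardsC s.
have : (#|H| <= #|M :\ A :\ B|.+1)%N.
  by rewrite /H cardsU1; apply: leq_add (leq_b1 _) (leq_imset_card _ _).
have := cardsD1 A M; have := cardsD1 B (M :\ A).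
rewrite in_setD1 AM BM eq_sym AB /=; move: leM.
move: #|M| #|M :\ A| #|M :\ A :\ B| #|H| #|~: H| #|s| #|~: s| #|'I_m|; lia.
Qed.

End Codimension.

(** * Disjoint minimal nonfaces and joins of boundaries *)

Section Presentations.

(** The combinatorial link between the algebra and the joins. Being nonempty and disjoint, the sets
    in [As] are exactly the minimal nonfaces. *)
Definition presentation (V : finType) (K : {set {set V}}) (As : seq {set V}) : Prop :=
  [/\ set0 \notin As, pairwise (fun A B : {set V} => [disjoint A & B]) As &
      forall B : {set V}, (B \in K) = all (fun A : {set V} => ~~ (A \subset B)) As].

Lemma boundary_presentation n : 0 < n -> presentation (boundary n) [:: setT].
Proof.
move=> n_gt0; split=> [||B] //=.
- rewrite inE eq_sym -card_gt0 cardsT card_ord; first by [].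
- by rewrite inE andbT subTset.
Qed.

Lemma simplex_presentation r : presentation (simplex r) [::].
Proof. by split=> // B; rewrite inE. Qed.

Lemma join_presentation (V W : finType) (K : {set {set V}}) (L : {set {set W}}) As Bs :
    presentation K As -> presentation L Bs ->
  presentation (join K L)
    ([seq (@inl V W) @: (A : {set V}) | A <- As]
     ++ [seq (@inr V W) @: (B : {set W}) | B <- Bs]).
Proof.
move=> [As0 As_disj KE] [Bs0 Bs_disj LE].
have inl_inj : injective (@inl V W) by move=> ? ? [].
have inr_inj : injective (@inr V W) by move=> ? ? [].
split=> [||B].
- rewrite mem_cat negb_or; apply/andP; split; apply/negP => /mapP [A AP /esym/eqP].
    by rewrite imset_eq0 => /eqP A0; rewrite -A0 AP in As0.
  by rewrite imset_eq0 => /eqP A0; rewrite -A0 AP in Bs0.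
- rewrite pairwise_cat; apply/and3P; split.
  + apply/allrelP => _ _ /mapP [A _ ->] /mapP [B _ ->].
    by apply/pred0Pn => -[_ /andP [/= /imsetP [v _ ->] /imsetP [w _]]].
  + rewrite pairwise_map; apply: sub_pairwise As_disj => A B /=.
    by rewrite -!setI_eq0 -imsetI ?imset_eq0 //; apply: in2W.
  + rewrite pairwise_map; apply: sub_pairwise Bs_disj => A B /=.
    by rewrite -!setI_eq0 -imsetI ?imset_eq0 //; apply: in2W.
- rewrite inE KE LE all_cat !all_map; congr andb; apply: eq_all => A /=; congr negb;
    apply/subsetP/subsetP => [AB _ /imsetP [v vA ->]|AB v vA].
  + by have := AB v vA; rewrite inE.
  + by rewrite inE; apply/AB/imset_f.
  + by have := AB v vA; rewrite inE.
  + by rewrite inE; apply/AB/imset_f.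
Qed.

Lemma join_boundaries_presentation ns :
  all (fun n => 0 < n) ns -> exists As, presentation (join_boundaries ns) As.
Proof.
elim: ns => [_|n ns IHns /= /andP [/boundary_presentation nP /IHns [As AsP]]].
  by exists [::]; split=> // B; rewrite inE; apply/eqP/setP => -[].
by have := join_presentation nP AsP; set Bs := cat _ _; exists Bs.
Qed.

Lemma isomorphic_presentation (V W : finType) (K : {set {set V}})
    (L : {set {set W}}) Bs :
    (forall v, [set v] \in K) -> isomorphic K L -> presentation L Bs ->
  exists As, presentation K As.
Proof.
move=> K1 [f [/bij_inj f_inj fP]] [Bs0 Bs_disj LE].
pose vertex v : {v : V | [set v] \in K} := exist _ v (K1 v).
pose g v := val (f (vertex v)).
have g_inj : injective g by move=> v w /val_inj/f_inj/(congr1 val).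
have KL (B : {set V}) : (B \in K) = (g @: B \in L).
  have := fP [set u | val u \in B].
  have -> : [set val u | u in [set u : {v : V | [set v] \in K} | val u \in B]] = B.
    apply/setP => v; apply/imsetP/idP => [[u + ->]|vB]; first by rewrite inE.
    by exists (vertex v); rewrite ?inE.
  move=> ->; rewrite (_ : [set val (f u) | u in _] = g @: B) //.
  apply/setP => w; apply/imsetP/imsetP => [[u + ->]|[v vB ->]].
    rewrite inE => uB; exists (val u) => //; congr (val (f _)).
    exact: val_inj.
  by exists (vertex v); rewrite ?inE.
(* A set that leaves the image of [g] lies in no [g @: B] and imposes no condition; this discards
   the points of [W] that are not vertices. *)
exists [seq g @^-1: A | A : {set W} <- Bs & A \subset codom g]; split=> [||B].
- apply/negP => /mapP [A]; rewrite mem_filter => /andP [/subsetP Ag ABs] /setP A0.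
  suff A_0 : A = set0 by rewrite -A_0 ABs in Bs0.
  apply/setP => w; rewrite inE; apply/negP => wA.
  by have /codomP [v wE] := Ag w wA; have := A0 v; rewrite !inE -wE wA.
- rewrite pairwise_map; apply: sub_pairwise (pairwise_filter _ Bs_disj) => A B /=.
  rewrite -!setI_eq0 -preimsetI => /eqP ->.
  by rewrite preimset0.
- rewrite KL LE all_map all_filter; apply: eq_all => A /=.
  have [Ag|/negP NAg] := boolP (A \subset codom g); last first.
    apply/negP => /subsetP Ag; apply: NAg; apply/subsetP => w /Ag.
    by case/imsetP => v _ ->; apply: codom_f.
  congr negb; apply/subsetP/subsetP => [AB v|AB w wA].
    by rewrite inE => /AB; rewrite mem_imset.
  have /codomP [v wE] := subsetP Ag w wA.
  by rewrite wE; apply/imset_f/AB; rewrite inE -wE.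
Qed.

Lemma bij_isomorphic (V W : finType) (K : {set {set V}}) (L : {set {set W}})
    (g : W -> V) :
  bijective g -> (forall B, (B \in K) = (g @^-1: B \in L)) -> isomorphic K L.
Proof.
move=> [g' gK g'K] KL.
have KL1 v : ([set v] \in K) = ([set g' v] \in L).
  rewrite KL (_ : g @^-1: [set v] = [set g' v]) //.
  by apply/setP => w; rewrite !inE (can2_eq gK g'K).
pose f (u : {v : V | [set v] \in K}) : {w : W | [set w] \in L} :=
  exist _ (g' (val u)) (etrans (esym (KL1 (val u))) (valP u)).
have L1 (w : W) : [set w] \in L -> [set g w] \in K by rewrite KL1 gK.
exists f; split.
  exists (fun u => exist _ (g (val u)) (L1 _ (valP u))) => u; apply: val_inj.
  - exact: g'K.
  - exact: gK.
move=> A; rewrite KL (_ : g @^-1: _ = [set val (f u) | u in A]) //.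
apply/setP => w; rewrite inE; apply/imsetP/imsetP => [[u uA gwE]|[u uA ->]].
- by exists u => //; rewrite /= -gwE gK.
- by exists u => //=; rewrite g'K.
Qed.

(** Each set of [As] is enumerated by its own block of points; disjointness makes the combined map
    injective, with the union of [As] as image. *)
Lemma presentation_join_boundaries (V : finType) (As : seq {set V}) :
    pairwise (fun A B : {set V} => [disjoint A & B]) As ->
  exists g : join_points [seq #|A : {set V}| | A <- As] -> V,
    [/\ injective g,
        forall v, (v \in codom g) = has (fun A : {set V} => v \in A) As &
        forall B : {set V}, (g @^-1: B \in join_boundaries _)
          = all (fun A : {set V} => ~~ (A \subset B)) As].
Proof.
elim: As => [_|A As IHAs /= /andP [/allP A_disj /IHAs [g [g_inj gE gB]]]].
  exists (fun w : void => match w with end); split=> [[]|v|B] //.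
    by apply/codomP => -[[]].
  by rewrite inE; apply/eqP/setP => -[].
pose g1 (w : 'I_#|A| + join_points [seq #|A : {set V}| | A <- As]) :=
  match w with inl i => enum_val i | inr w => g w end.
have gA w : g w \in A = false.
  apply/negP => gwA; have := codom_f g w; rewrite gE => /hasP [B /A_disj AB gwB].
  by rewrite (disjointFr AB gwA) in gwB.
exists g1; split.
- move=> [i|w] [j|w'] /= gwE.
  + by rewrite (enum_val_inj gwE).
  + by have := enum_valP i; rewrite gwE gA.
  + by have := enum_valP j; rewrite -gwE gA.
  + by rewrite (g_inj _ _ gwE).
- move=> v; apply/codomP/orP => [[[i|w] ->]|[vA|]].
  + by left; apply: enum_valP.
  + by right; rewrite -gE; apply: codom_f.
  + by exists (inl (enum_rank_in vA v)); rewrite /= enum_rankK_in.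
  + by rewrite -gE => /codomP [w ->]; exists (inr w).
- move=> B; rewrite inE -gB; congr andb; last first.
    rewrite (_ : [set w | _] = g @^-1: B) //.
    by apply/setP => w; rewrite !inE.
  rewrite inE; congr negb; apply/eqP/subsetP => [BT v vA|AB].
    have := in_setT (enum_rank_in vA v).
    by rewrite -BT !inE /= enum_rankK_in.
  by apply/setP => i; rewrite !inE; apply/AB/enum_valP.
Qed.

Lemma presentation_isomorphic (V : finType) (K : {set {set V}}) As :
  presentation K As ->
  exists ns : seq nat, all (fun n => 0 < n) ns /\
    (isomorphic K (join_boundaries ns) \/
     exists r, 0 < r /\ isomorphic K (join (simplex r) (join_boundaries ns))).
Proof.
move=> [As0 /presentation_join_boundaries [g [g_inj gE gB]] KE].
exists [seq #|A : {set V}| | A <- As]; split.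
  rewrite all_map; apply/allP => A AAs /=; rewrite card_gt0.
  by apply: contraNneq As0 => <-.
(* The points in no minimal nonface span the simplex factor, which is present only when there are
   such points, as [r] is positive. *)
pose R := [set v | v \notin codom g].
have [R0|[v0 v0R]] := set_0Vmem R; [left | right; exists #|R|; split].
- apply: (bij_isomorphic (g := g)) => [|B]; last by rewrite gB KE.
  have /fin_all_exists [g' g'K] v : exists w, g w = v.
    have : v \notin R by rewrite R0 inE.
    by rewrite inE negbK => /codomP [w ->]; exists w.
  by exists g' => // w; apply: g_inj; rewrite g'K.
- by apply/card_gt0P; exists v0.
pose g1 (w : 'I_#|R| + join_points [seq #|A : {set V}| | A <- As]) :=
  match w with inl i => enum_val i | inr w => g w end.
have gR w : g w \in R = false by rewrite inE codom_f.
apply: (bij_isomorphic (g := g1)) => [|B]; last first.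
  rewrite inE [_ \in simplex _]inE KE -gB /=.
  rewrite (_ : [set w | _] = g @^-1: B) //.
  by apply/setP => w; rewrite !inE.
have g1_inj : injective g1.
  move=> [i|w] [j|w'] /= gwE.
  + by rewrite (enum_val_inj gwE).
  + by have := enum_valP i; rewrite gwE gR.
  + by have := enum_valP j; rewrite -gwE gR.
  + by rewrite (g_inj _ _ gwE).
have /fin_all_exists [g' g'K] v : exists w, g1 w = v.
  have [vR|] := boolP (v \in R).
    by exists (inl (enum_rank_in vR v)); rewrite /= enum_rankK_in.
  by rewrite inE negbK => /codomP [w ->]; exists (inr w).
by exists g' => // w; apply: g1_inj; rewrite g'K.
Qed.

End Presentations.

(** * The three equivalent conditions *)

Lemma taut_facet (F : fieldType) (m : nat) (K : {set {set 'I_m}}) :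
  simplicial_complex K ->
  exists s : {set 'I_m}, [/\ s \in K, forall A, A \in K -> #|A| <= #|s| &
    taut F K = total_tor_dim (@sr_ideal F m K) (2 ^ #|~: s|)].
Proof.
move=> [K0 _ _]; have [|s sK sE] := @eq_bigmax_cond _ (mem K) (fun A => #|A|).
  by apply/card_gt0P; exists set0.
exists s; split=> // [A AK|].
  by rewrite -sE; apply: (leq_bigmax_cond (P := mem K) (F := fun A : {set 'I_m} => #|A|)).
rewrite /taut /dimK sE; congr (total_tor_dim _ (2 ^ _)).
(* The shift in [dimK] cancels the one in the exponent, leaving [m - #|s|]. *)
by have := cardsC s; rewrite card_ord; lia.
Qed.

Theorem theorem1p6 (F : fieldType) (m : nat) (K : {set {set 'I_m}})
    (hK : simplicial_complex K) :
  (taut F K <-> complete_intersection (@sr_ideal F m K)) /\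
  (complete_intersection (@sr_ideal F m K) <->
   exists ns : seq nat,
     all (fun n : nat => 0 < n) ns /\
     (isomorphic K (join_boundaries ns) \/
      exists r : nat,
        0 < r /\ isomorphic K (join (simplex r) (join_boundaries ns)))).
Proof.
have [s [sK s_max tautE]] := taut_facet F hK.
(* The implications run in a cycle from complete intersection to taut to a presentation and back;
   the join description is then matched with presentations. *)
have ci_taut : complete_intersection (@sr_ideal F m K) -> taut F K.
  rewrite tautE => -[gs [gs_reg gsE]].
  by have := total_tor_dim_regular_generators hK sK s_max gs_reg gsE.
have taut_pres : taut F K -> exists As, presentation K As.
  rewrite tautE => /(card_minimal_nonfaces_taut hK sK s_max).
  move=> /(few_minimal_nonfaces_disjoint hK sK s_max) disj.
  exists (enum (minimal_nonfaces K)); split=> //.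
  - by rewrite mem_enum set0_minimal_nonface.
  - exact: face_minimal_nonfaces.
have pres_ci As : presentation K As -> complete_intersection (@sr_ideal F m K).
  move=> [As0 disj KE]; exists (map (xset F) As); split.
  - exact: disjoint_regular_sequence.
  - exact: sr_ideal_presentation.
split; split=> //.
- by move=> /taut_pres [As] /pres_ci.
- by move=> /ci_taut /taut_pres [As] /presentation_isomorphic.
have [_ K1 _] := hK.
move=> [ns [/join_boundaries_presentation [As AsP] [iso|[r [_ iso]]]]].
- by have [Bs /pres_ci] := isomorphic_presentation K1 iso AsP.
- have rP := join_presentation (simplex_presentation r) AsP.
  by have [Bs /pres_ci] := isomorphic_presentation K1 iso rP.
Qed.
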